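(* Let $G$ be a simple connected graph with $n$ vertices and $m$ edges. Then $$DEE(G)\geq e^{\frac{2W(G)}{n}}+\frac{n-1}{e^{\frac{2W(G)}{n(n-1)}}},$$ where $W(G)$ denotes the Wiener index of the graph $G$. Moreover, equality holds if and only if $G$ is the complete graph $K_{n}$.
   Context: Let $G$ be a simple connected graph with vertex set $\{v_1,\dots,v_n\}$. Its distance matrix $D(G)=(d_{ij})$ is the $n\times n$ matrix whose entry $d_{ij}$ is the distance (length of a shortest path) between $v_i$ and $v_j$. The $D$-eigenvalues $\mu_1\ge\mu_2\ge\cdots\ge\mu_n$ of $G$ are the (real) eigenvalues of $D(G)$, counted with multiplicity. The distance Estrada index of $G$ is $DEE(G)=\sum_{i=1}^n e^{\mu_i}$. The distance degree of $v_i$ is $D_i=\sum_{j=1}^n d_{ij}$, and the Wiener index of $G$ is $W(G)=\frac12\sum_{i=1}^n D_i$. *)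

(* Defs.v *)
From HB Require Import structures.
From mathcomp Require Import all_boot all_order all_algebra.
From mathcomp Require Import polyrcf complex.
From mathcomp Require Import reals sequences exp.
Set Implicit Arguments.
Unset Strict Implicit.
Unset Printing Implicit Defensive.
Import Order.TTheory GRing.Theory Num.Theory.
Local Open Scope ring_scope.

(* Graphs on the vertex set 'I_n are given by their adjacency relation. *)

Definition simple_graph n (e : rel 'I_n) : Prop :=
  symmetric e /\ irreflexive e.

Definition connected_graph n (e : rel 'I_n) : Prop :=
  (0 < n)%N /\ forall i j : 'I_n, connect e i j.

Definition edge_set n (e : rel 'I_n) : {set {set 'I_n}} :=
  [set [set p.1; p.2] | p : 'I_n * 'I_n & e p.1 p.2].

Definition complete_graph n : rel 'I_n := [rel i j | i != j].

Definition has_path n (e : rel 'I_n) (i j : 'I_n) (k : nat) : bool :=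
  [exists p : k.-tuple 'I_n, [&& path e i p, last i p == j & uniq (i :: p)]].

(* A path has fewer than n edges, so this search, which returns the first
   length that works, misses none; its value is n if there is no path. *)
Definition dist n (e : rel 'I_n) (i j : 'I_n) : nat :=
  find (has_path e i j) (iota 0 n).

Definition distance_matrix (R : realType) n (e : rel 'I_n) : 'M[R]_n :=
  \matrix_(i, j) (dist e i j)%:R.

Definition distance_degree (R : realType) n (e : rel 'I_n) (i : 'I_n) : R :=
  \sum_(j < n) distance_matrix R e i j.

Definition wiener_index (R : realType) n (e : rel 'I_n) : R :=
  2^-1 * \sum_(i < n) distance_degree R e i.

(* rootsR lists the distinct real roots in increasing order, and
   mup x p is the multiplicity of x as a root of p. *)
Definition eigenvalues (R : realType) n (A : 'M[R]_n) : seq R :=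
  rev (flatten [seq nseq (mup x (char_poly A)) x
               | x <- rootsR (char_poly A)]).

Definition distance_estrada_index (R : realType) n (e : rel 'I_n) : R :=
  \sum_(mu <- eigenvalues (distance_matrix R e)) expR mu.

Lemma eigenvalues_perm (R : realType) n (A : 'M[R]_n) (s : seq R) :
  char_poly A = \prod_(x <- s) ('X - x%:P) -> perm_eq (eigenvalues A) s.
Proof.
move=> As; apply/allP => x _ /=; apply/eqP.
have p0 : char_poly A != 0 by rewrite monic_neq0 ?char_poly_monic.
rewrite count_rev count_flatten -map_comp sumnE big_map.
under eq_bigr do rewrite /= count_nseq /=.
have -> : count_mem x s = mup x (char_poly A) by rewrite As mu_prod_XsubC.
have [xr|xr] := boolP (x \in rootsR (char_poly A)).
  rewrite (bigD1_seq x) ?uniq_roots //= eqxx mul1n big1 ?addn0 // => y yx.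
  by rewrite (negPf yx) mul0n.
rewrite big1_seq => [|y /andP[_ yr]].
  rewrite mupNroot //; apply: contra xr => rx.
  by rewrite -roots_on_rootsR // inE.
by case: eqP yr => [->|]; rewrite ?(negPf xr).
Qed.

(* A real symmetric matrix of order n has n eigenvalues, all real. *)
Lemma char_poly_eigenvalues (R : realType) n (A : 'M[R]_n) :
  A^T = A -> char_poly A = \prod_(x <- eigenvalues A) ('X - x%:P).
Proof.
move=> symA.
suff [s As] : exists s : seq R, char_poly A = \prod_(x <- s) ('X - x%:P).
  by rewrite (perm_big _ (eigenvalues_perm As)).
pose f := real_complex R.
pose B := map_mx f A.
have hB : B \is hermsymmx.
  apply: realsym_hermsym.
    apply/is_hermitianmxP; rewrite expr0 scale1r map_mx_id //.
    by apply/matrixP => i j; rewrite !mxE -[in LHS]symA mxE.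
  by apply/mxOverP => i j; rewrite mxE complex_real.
have /orthomx_spectralP BE := hermitian_normalmx hB.
have dr := hermitian_spectral_diag_real hB.
exists [seq complex.Re (spectral_diag B 0 i) | i <- enum 'I_n].
apply: (map_poly_inj f); rewrite map_char_poly -/B.
have PP : map_mx polyC (invmx (spectralmx B)) *m map_mx polyC (spectralmx B)
          = 1%:M by rewrite -map_mxM mulVmx ?spectral_unit // map_mx1.
rewrite /char_poly /char_poly_mx [in LHS]BE.
have -> : 'X%:M - map_mx polyC (invmx (spectralmx B) *m
              diag_mx (spectral_diag B) *m spectralmx B)
   = map_mx polyC (invmx (spectralmx B)) *m
     char_poly_mx (diag_mx (spectral_diag B)) *m map_mx polyC (spectralmx B).
  rewrite mulmxBr mulmxBl !map_mxM scalar_mxC -[in RHS](mulmxA _%:M).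
  by rewrite PP mulmx1.
rewrite !det_mulmx mulrAC -det_mulmx PP det1 mul1r -/(char_poly _).
rewrite char_poly_trig ?diag_mx_is_trig // rmorph_prod big_map big_enum /=.
apply: eq_bigr => i _; rewrite map_polyXsubC mxE eqxx mulr1n.
congr (_ - _%:P); symmetry.
exact: (RRe_real (mxOverP dr 0 i)).
Qed.

Lemma size_eigenvalues (R : realType) n (A : 'M[R]_n) :
  A^T = A -> size (eigenvalues A) = n.
Proof.
move=> /char_poly_eigenvalues /(congr1 (size : {poly R} -> nat)).
by rewrite size_char_poly size_prod_XsubC => -[].
Qed.

(* Main.v *)
Require Import Defs.
From mathcomp Require Import all_boot all_order all_algebra.
From mathcomp Require Import reals sequences exp.
From mathcomp Require Import complex zify ring lra.
Import Order.TTheory GRing.Theory Num.Theory.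
Local Open Scope ring_scope.

(** Let [D] be the distance matrix, [x0] its largest eigenvalue,
    [x = 2W/n] and [k = x/(n-1)].  Since [D] is a real symmetric matrix, its
    Rayleigh quotient at the all-ones vector, which is [x], is at most [x0]
    ([mean_distance_degree_le]); and since [D] has zero diagonal, its
    eigenvalues sum to [0].

    The convexity of the exponential then gives the bound: bound [exp] from
    below by its tangent at [x] for the eigenvalue [x0], and by its tangent at
    [-k] for the [n-1] others.  As the eigenvalues sum to [0] and
    [x = (n-1)k], the sum of the tangent values is the announced bound plus
    [(exp x - exp (-k)) (x0 - x)], which is nonnegative ([sum_expR_ge]).

    If equality holds, every tangent inequality is an equality, so the
    spectrum is [x] once and [-k] repeated [n-1] times.  Hence
    [tr (D^2) = x^2 + (n-1) k^2], while [tr (D^2)] is the sum of the squared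
    distances.  The off-diagonal entries of [D] have mean [k], and their
    squares sum to [n(n-1) k^2], so they have zero variance
    ([distance_variance]): all distances between distinct vertices are equal.
    A connected graph with two distinct vertices has an edge, so this common
    distance is [1] and the graph is complete ([equidistant_complete]).

    Conversely the eigenvalues of the complete graph all lie in
    [{-1, n-1}] ([complete_eigenvalue]).  On these two points [exp] agrees
    with an affine function, so that the sum of the exponentials depends only
    on the number of eigenvalues and on their sum, which are [n] and [0]; no
    multiplicity has to be computed ([complete_estrada_index]).

    For [n = 1] the quotient [k] is a division by 0, but [x = 0 = (n-1)k] holds
    all the same, so the argument covers this case. *)

(** * Spectral theory of real symmetric matrices *)

Lemma char_poly_similar (F : comUnitRingType) (n : nat) (P A : 'M[F]_n) :
  P \in unitmx -> char_poly (invmx P *m A *m P) = char_poly A.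
Proof.
move=> Pu.
have PP : map_mx polyC (invmx P) *m map_mx polyC P = 1%:M.
  by rewrite -map_mxM mulVmx // map_mx1.
rewrite /char_poly.
have -> : char_poly_mx (invmx P *m A *m P)
    = map_mx polyC (invmx P) *m char_poly_mx A *m map_mx polyC P.
  rewrite /char_poly_mx mulmxBr mulmxBl !map_mxM scalar_mxC.
  by rewrite -[in RHS](mulmxA _%:M) PP mulmx1.
by rewrite !det_mulmx mulrAC -det_mulmx PP det1 mul1r.
Qed.

(** A real symmetric matrix is diagonalized by a complex unitary matrix, and
    the diagonal entries, which are real, are its eigenvalues with
    multiplicity. *)
Lemma real_spectral_decomposition (R : realType) (n : nat) (A : 'M[R]_n) :
  A^T = A ->
  exists (U : 'M[R[i]]_n) (d : 'I_n -> R),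
    [/\ U \is unitarymx,
        map_mx (real_complex R) A =
          invmx U *m diag_mx (\row_i (d i)%:C%C) *m U &
        perm_eq (eigenvalues A) (codom d)].
Proof.
move=> symA; set B := map_mx _ A.
have hB : B \is hermsymmx.
  apply: realsym_hermsym.
    apply/is_hermitianmxP; rewrite expr0 scale1r map_mx_id //.
    by apply/matrixP => i j; rewrite !mxE -[in LHS]symA mxE.
  by apply/mxOverP => i j; rewrite mxE complex_real.
have Uu := spectral_unitarymx B.
have /orthomx_spectralP BE := hermitian_normalmx hB.
have /mxOverP dr := hermitian_spectral_diag_real hB.
have [d dE] : exists d : 'I_n -> R, spectral_diag B = \row_i (d i)%:C%C.
  exists (fun i => complex.Re (spectral_diag B 0 i)).
  by apply/rowP => i; rewrite mxE; exact/esym/(RRe_real (dr 0 i)).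
rewrite {}dE in BE.
exists (spectralmx B), d; split => //.
apply: eigenvalues_perm; rewrite big_image /=.
apply: (map_poly_inj (real_complex R)).
rewrite map_char_poly -/B BE char_poly_similar ?spectral_unit //.
rewrite char_poly_trig ?diag_mx_is_trig // rmorph_prod.
by apply: eq_bigr => i _ /=; rewrite map_polyXsubC !mxE eqxx mulr1n.
Qed.

Lemma mxtrace_eigenvalues (R : realType) (n : nat) (A : 'M[R]_n) :
  A^T = A -> \tr A = \sum_(x <- eigenvalues A) x.
Proof.
move=> /real_spectral_decomposition[U [d [Uu AE eigE]]].
rewrite (perm_big _ eigE) big_image /=.
apply: (fmorph_inj (real_complex R)).
rewrite -trace_map_mx AE mxtrace_mulC mulmxA mulmxV ?unitarymx_unit //.
rewrite mul1mx mxtrace_diag rmorph_sum.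
by apply: eq_bigr => i _; rewrite mxE.
Qed.

Lemma mxtrace_sqr_eigenvalues (R : realType) (n : nat) (A : 'M[R]_n) :
  A^T = A -> \tr (A *m A) = \sum_(x <- eigenvalues A) x ^+ 2.
Proof.
move=> /real_spectral_decomposition[U [d [Uu AE eigE]]].
rewrite (perm_big _ eigE) big_image /=.
apply: (fmorph_inj (real_complex R)).
have Uunit := unitarymx_unit Uu.
rewrite -trace_map_mx map_mxM AE !mulmxA mulmxK //.
rewrite mxtrace_mulC !mulmxA mulmxV // mul1mx mulmx_diag mxtrace_diag.
rewrite rmorph_sum.
by apply: eq_bigr => i _; rewrite !mxE rmorphXn expr2.
Qed.

(** In an orthonormal eigenbasis, with [v] the coordinates of [u], the
    quadratic form of [A] at [u] is [\sum_i d i * |v i|^2]. *)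
Lemma rayleigh_le (R : realType) (n : nat) (A : 'M[R]_n) (M : R) (u : 'rV_n) :
  A^T = A -> {in eigenvalues A, forall x, x <= M} ->
  (u *m A *m u^T) 0 0 <= M * (u *m u^T) 0 0.
Proof.
move=> /real_spectral_decomposition[U [d [Uu AE eigE]]] leM.
have dM i : d i <= M by apply: leM; rewrite (perm_mem eigE) codom_f.
pose f := real_complex R; pose v := map_mx f u *m invmx U.
have vE (D : 'M_n) :
    map_mx f u *m (invmx U *m D *m U) *m (map_mx f u)^T = v *m D *m (v ^t* )%sesqui.
  have -> : (v ^t* )%sesqui = U *m (map_mx f u)^T.
    rewrite /v invmx_unitary // trmx_mul map_mxM !trmxCK.
    congr (_ *m _); apply/matrixP => i j; rewrite !mxE.
    exact: conjc_real.
  by rewrite !mulmxA.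
clearbody v.
have vn (c : 'I_n -> R) :
    (v *m diag_mx (\row_i (c i)%:C%C) *m (v ^t* )%sesqui) 0 0
    = \sum_i (c i)%:C%C * `|v 0 i| ^+ 2.
  rewrite mxE; apply: eq_bigr => i _.
  by rewrite mul_mx_diag !mxE normCK mulrCA mulrA.
rewrite -lecR rmorphM /=.
have -> : ((u *m A *m u^T) 0 0)%:C%C = (map_mx f (u *m A *m u^T)) 0 0.
  by rewrite [RHS]mxE.
have -> : ((u *m u^T) 0 0)%:C%C = (map_mx f (u *m u^T)) 0 0.
  by rewrite [RHS]mxE.
rewrite !map_mxM -map_trmx AE vE vn.
(* The squared norm of [u] is the quadratic form with all the [d i] set to 1. *)
have -> : map_mx f u *m (map_mx f u)^T
    = v *m diag_mx (\row_i (1 : R)%:C%C) *m (v ^t* )%sesqui.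
  rewrite -vE.
  suff -> : diag_mx (\row_(i < n) (1 : R)%:C%C) = 1%:M by
    rewrite mulmx1 mulVmx ?unitarymx_unit // mulmx1.
  by apply/matrixP => i j; rewrite !mxE.
rewrite vn mulr_sumr; apply: ler_sum => i _.
by rewrite mul1r ler_wpM2r ?exprn_ge0 // lecR.
Qed.

Lemma eigenvalues_eigenvalue (R : realType) (n : nat) (A : 'M[R]_n) (x : R) :
  A^T = A -> x \in eigenvalues A -> eigenvalue A x.
Proof.
move=> /char_poly_eigenvalues cpA xA.
by rewrite eigenvalue_root_char cpA root_prod_XsubC.
Qed.

(** * Tangent lines of the exponential *)

Lemma expR_tangent_leif (R : realType) (a x : R) :
  expR a * (1 + (x - a)) <= expR x ?= iff (x == a).
Proof.
have -> : expR x = expR a * expR (x - a) by rewrite -expRD addrC subrK.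
split; first by rewrite ler_pM2l ?expR_gt0 // expR_ge1Dx.
rewrite (inj_eq (mulfI (lt0r_neq0 (expR_gt0 a)))).
rewrite -[RHS]subr_eq0; have [->|xa] := eqVneq (x - a) 0.
  by rewrite addr0 expR0 eqxx.
by rewrite lt_eqF // expR_gt1Dx.
Qed.

Lemma sum_affine (R : comPzRingType) (s : seq R) (a b : R) :
  \sum_(y <- s) (a + b * y) = (size s)%:R * a + b * \sum_(y <- s) y.
Proof.
rewrite big_split -mulr_sumr big_const_seq count_predT /=.
by rewrite iter_addr_0 mulr_natl.
Qed.

(** The first tangent is taken at [x] and the others at [c]; the two linear
    constraints make the tangent values add up to the left-hand side of the inequality plus
    [(expR x - expR c) * (x0 - x)]. *)
Lemma sum_expR_ge (R : realType) (s : seq R) (x0 x c : R) :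
  c <= x -> x <= x0 -> x0 + \sum_(y <- s) y = 0 -> x + (size s)%:R * c = 0 ->
  expR x + (size s)%:R * expR c <= expR x0 + \sum_(y <- s) expR y
  /\ (expR x0 + \sum_(y <- s) expR y = expR x + (size s)%:R * expR c ->
      x0 = x /\ {in s, forall y, y = c}).
Proof.
move=> cx xx0 sum0 xc0.
(* The excess of [expR] at [y] over its tangent at [a]. *)
pose gap a y : R := expR y - expR a * (1 + (y - a)).
have gap_ge0 a y : 0 <= gap a y by rewrite subr_ge0 expR_tangent_leif.
have gap_eq0 a y : gap a y = 0 -> y = a.
  move/eqP; rewrite subr_eq0 eq_sym (expR_tangent_leif _ a y).2.
  by move/eqP.
have gapsE : \sum_(y <- s) gap c y
    = \sum_(y <- s) expR y - expR c * ((size s)%:R + (x - x0)).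
  rewrite /gap sumrB -mulr_sumr; congr (_ - _ * _).
  have -> : \sum_(y <- s) (1 + (y - c)) = \sum_(y <- s) ((1 - c) + 1 * y).
    by apply: eq_bigr => y _; ring.
  by rewrite sum_affine; lra.
have gaps_ge0 : 0 <= \sum_(y <- s) gap c y by apply: sumr_ge0.
have diffE : expR x0 + \sum_(y <- s) expR y - (expR x + (size s)%:R * expR c)
    = gap x x0 + \sum_(y <- s) gap c y + (expR x - expR c) * (x0 - x).
  by rewrite gapsE /gap; ring.
clearbody gap.
have last_ge0 : 0 <= (expR x - expR c) * (x0 - x).
  by rewrite mulr_ge0 ?subr_ge0 ?ler_expR.
have first_ge0 := gap_ge0 x x0.
split=> [|eq_sum]; first by rewrite -subr_ge0 diffE !addr_ge0.
have /eqP : gap x x0 + \sum_(y <- s) gap c y + (expR x - expR c) * (x0 - x) = 0.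
  by rewrite -diffE eq_sum subrr.
rewrite !paddr_eq0 ?addr_ge0 // -andbA => /and3P[/eqP/gap_eq0 -> + _].
rewrite psumr_eq0 // => /allP gs0; split=> // y ys.
by have /implyP/(_ isT)/eqP/gap_eq0 := gs0 y ys.
Qed.

(** * Distances in a graph *)

Lemma dist_refl (n : nat) (e : rel 'I_n) (i : 'I_n) : dist e i i = 0%N.
Proof.
rewrite /dist; case: n e i => [? []//|n] e i /=.
by rewrite ifT //; apply/existsP; exists [tuple]; rewrite /= eqxx.
Qed.

Lemma dist_eq1 (n : nat) (e : rel 'I_n) (i j : 'I_n) :
  i != j -> (dist e i j == 1%N) = e i j.
Proof.
move=> ij.
have n_gt1 : (1 < n)%N.
  rewrite ltnNge; apply: contra ij => n_le1; apply/eqP/val_inj.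
  by case: i j => [[|i] ilt] [[|j] jlt] //=; lia.
have p0 : has_path e i j 0 = false.
  by apply/existsP => -[p]; rewrite [p]tuple0 /= (negPf ij).
have p1 : has_path e i j 1 = e i j.
  apply/existsP/idP => [[p]|eij].
    by case/tupleP: p => k p; rewrite [p]tuple0 /= andbT => /andP[+ /andP[/eqP <-]].
  by exists [tuple j]; rewrite /= eij eqxx inE ij.
rewrite /dist; case: n n_gt1 e i j ij p0 p1 => [|[|n]] // _ e i j ij p0 p1.
by rewrite [LHS]/= p0 p1; case: (e i j).
Qed.

Lemma has_path_rev (n : nat) (e : rel 'I_n) (i j : 'I_n) (k : nat) :
  symmetric e -> has_path e i j k -> has_path e j i k.
Proof.
move=> e_sym /existsP[p /and3P[ep /eqP ijp up]]; apply/existsP.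
exists (rev_tuple (belast_tuple i p)); rewrite /= -ijp; apply/and3P; split.
- by rewrite rev_path; under eq_path => x y do rewrite e_sym.
- by case: (p : seq _) => //= x q; rewrite rev_cons last_rcons.
- rewrite -[X in is_true X]/(uniq (last i p :: rev (belast i p))).
  by rewrite -rev_rcons -lastI rev_uniq.
Qed.

Lemma dist_sym (n : nat) (e : rel 'I_n) (i j : 'I_n) :
  symmetric e -> dist e i j = dist e j i.
Proof.
move=> e_sym; apply: eq_find => k.
by apply/idP/idP; apply: has_path_rev.
Qed.

(** * The distance matrix *)

Lemma distance_matrix_sym (R : realType) (n : nat) (e : rel 'I_n) :
  symmetric e -> (distance_matrix R e)^T = distance_matrix R e.
Proof. by move=> e_sym; apply/matrixP => i j; rewrite !mxE dist_sym. Qed.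

Lemma mxtrace_distance_matrix (R : realType) (n : nat) (e : rel 'I_n) :
  \tr (distance_matrix R e) = 0.
Proof. by rewrite /mxtrace big1 // => i _; rewrite mxE dist_refl. Qed.

Lemma wiener_indexE (R : realType) (n : nat) (e : rel 'I_n) :
  2 * wiener_index R e = \sum_i \sum_j distance_matrix R e i j.
Proof. by rewrite /wiener_index mulVKf ?pnatr_eq0. Qed.

Lemma wiener_index_ge0 (R : realType) (n : nat) (e : rel 'I_n) :
  0 <= wiener_index R e.
Proof.
rewrite /wiener_index mulr_ge0 ?invr_ge0 //.
by do 2![apply: sumr_ge0 => ? _]; rewrite mxE.
Qed.

Lemma sum_neq (R : pzRingType) (n : nat) (i : 'I_n) (F : 'I_n -> R) :
  \sum_j F j * (i != j)%:R = (\sum_j F j) - F i.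
Proof.
rewrite [in RHS](bigD1 i) //= addrAC subrr add0r [LHS](bigD1 i) //= eqxx mulr0 add0r.
by apply: eq_bigr => j ji; rewrite eq_sym ji mulr1.
Qed.

Lemma sum_distinct_pairs (R : pzRingType) (n : nat) :
  \sum_(i < n) \sum_(j < n) (i != j)%:R = n%:R * (n%:R - 1) :> R.
Proof.
rewrite (eq_bigr (fun=> n%:R - 1)) => [|i _].
  by rewrite sumr_const card_ord mulr_natl.
rewrite (eq_bigr (fun j => 1 * (i != j)%:R)) => [|j _]; last by rewrite mul1r.
by rewrite sum_neq sumr_const card_ord.
Qed.

Lemma mxtrace_sqr_distance_matrix (R : realType) (n : nat) (e : rel 'I_n) :
  symmetric e ->
  \tr (distance_matrix R e *m distance_matrix R e)
    = \sum_i \sum_j distance_matrix R e i j ^+ 2.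
Proof.
move=> e_sym; apply: eq_bigr => i _; rewrite mxE; apply: eq_bigr => j _.
by rewrite !mxE (dist_sym _ _ j i) // expr2.
Qed.

(** Up to a factor, the mean square deviation from [k] of the distances between
    distinct vertices. *)
Lemma distance_variance (R : realType) (n : nat) (e : rel 'I_n) (k : R) :
  symmetric e ->
  \sum_i \sum_j (distance_matrix R e i j - k * (i != j)%:R) ^+ 2
  = \tr (distance_matrix R e *m distance_matrix R e)
    - 2 * k * (2 * wiener_index R e) + k ^+ 2 * (n%:R * (n%:R - 1)).
Proof.
move=> e_sym; rewrite mxtrace_sqr_distance_matrix // wiener_indexE.
rewrite -sum_distinct_pairs.
rewrite !mulr_sumr -sumrB -big_split; apply: eq_bigr => i _ /=.
rewrite !mulr_sumr -sumrB -big_split; apply: eq_bigr => j _ /=.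
have [<-|ij] := eqVneq i j; first by rewrite mxE dist_refl /= ?mulr0n; ring.
by rewrite /= ?mulr1n; ring.
Qed.

(** The mean distance degree is the Rayleigh quotient of the distance matrix at
    the all-ones vector. *)
Lemma mean_distance_degree_le (R : realType) (n : nat) (e : rel 'I_n) (M : R) :
  (0 < n)%N -> symmetric e ->
  {in eigenvalues (distance_matrix R e), forall x, x <= M} ->
  2 * wiener_index R e / n%:R <= M.
Proof.
move=> n_gt0 e_sym leM.
pose u : 'rV[R]_n := const_mx 1.
have := rayleigh_le _ _ _ _ u (distance_matrix_sym _ _ _ e_sym) leM.
rewrite ler_pdivrMr ?ltr0n // wiener_indexE.
have -> : (u *m distance_matrix R e *m u^T) 0 0
    = \sum_i \sum_j distance_matrix R e i j.
  rewrite mxE [RHS]exchange_big /=; apply: eq_bigr => i _; rewrite !mxE mulr1.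
  by apply: eq_bigr => j _; rewrite !mxE mul1r.
suff -> : (u *m u^T) 0 0 = n%:R by [].
rewrite mxE (eq_bigr (fun=> 1)) => [|i _]; last by rewrite !mxE mulr1.
by rewrite sumr_const card_ord.
Qed.

(** * The complete graph *)

(** In a connected graph, any vertex with another vertex has a neighbour, so the
    common distance is 1. *)
Lemma equidistant_complete (n : nat) (e : rel 'I_n) (R : realType) (k : R) :
  irreflexive e -> connected_graph e ->
  (forall i j, i != j -> (dist e i j)%:R = k) -> e =2 complete_graph (n := n).
Proof.
move=> e_irr [_ e_conn] distk i j /=.
have [<-|ij] := eqVneq i j; first by rewrite e_irr /complete_graph /= ?eqxx.
have [z eiz] : exists z, e i z.
  have /connectP[[|z p] /=] := e_conn i j; last by case/andP; exists z.
  by move=> _ ji; rewrite ji eqxx in ij.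
have iz : i != z by apply: contraTneq eiz => <-; rewrite e_irr.
have /eqP diz : dist e i z == 1%N by rewrite dist_eq1.
have distE : (dist e i j)%:R = (dist e i z)%:R :> R by rewrite !distk.
by move/eqP: distE; rewrite eqr_nat diz dist_eq1 // => ->.
Qed.

Lemma complete_distance_matrix (R : realType) (n : nat) (e : rel 'I_n) i j :
  e =2 complete_graph (n := n) -> distance_matrix R e i j = (i != j)%:R.
Proof.
move=> eK; rewrite mxE; have [->|ij] := eqVneq i j; first by rewrite dist_refl.
by have /eqP -> : dist e i j == 1%N by rewrite dist_eq1 // eK.
Qed.

(** With [S] the sum of the coordinates of an eigenvector [v], the eigenvalue
    equation reads [S = (x + 1) v_i] for every [i]; summing over [i] gives
    [n S = (x + 1) S]. *)
Lemma complete_eigenvalue (R : realType) (n : nat) (e : rel 'I_n) (x : R) :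
  e =2 complete_graph (n := n) -> eigenvalue (distance_matrix R e) x ->
  (x == -1) || (x == n%:R - 1).
Proof.
move=> eK /eigenvalueP[v vD v0].
pose S := \sum_i v 0 i.
have vS i : S = (x + 1) * v 0 i.
  move/rowP/(_ i): vD; rewrite !mxE.
  under eq_bigr do rewrite complete_distance_matrix // eq_sym.
  by rewrite sum_neq -/S => /(canRL (subrK _)) ->; rewrite mulrDl mul1r.
have : (x + 1 - n%:R) * S = 0.
  suff SnE : (x + 1) * S = n%:R * S by rewrite mulrBl SnE subrr.
  rewrite [in LHS]/S mulr_sumr (eq_bigr (fun=> S)) => [|i _]; last by rewrite -vS.
  by rewrite sumr_const card_ord mulr_natl.
move/eqP; rewrite mulf_eq0 => /orP[xn|/eqP S0].
  by apply/orP; right; rewrite -subr_eq0 opprB addrA.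
have /rV0Pn[i vi] := v0.
have /esym/eqP := vS i; rewrite S0 mulf_eq0 (negPf vi) orbF addr_eq0.
by move=> ->.
Qed.

Lemma wiener_index_complete (R : realType) (n : nat) (e : rel 'I_n) :
  e =2 complete_graph (n := n) -> 2 * wiener_index R e = n%:R * (n%:R - 1).
Proof.
move=> eK; rewrite wiener_indexE -sum_distinct_pairs.
by do 2![apply: eq_bigr => ? _]; rewrite complete_distance_matrix.
Qed.

Lemma complete_estrada_index (R : realType) (n : nat) (e : rel 'I_n) :
  (0 < n)%N -> symmetric e -> e =2 complete_graph (n := n) ->
  distance_estrada_index R e = expR (n%:R - 1) + (n%:R - 1) * expR (-1).
Proof.
move=> n_gt0 e_sym eK; have Dsym := distance_matrix_sym R _ _ e_sym.
have n0 : n%:R != 0 :> R by rewrite pnatr_eq0 -lt0n.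
(* On -1 and n - 1 the exponential agrees with the affine function
   [y |-> (expR (-1) + b) + b * y]. *)
pose b : R := (expR (n%:R - 1) - expR (-1)) / n%:R.
rewrite /distance_estrada_index.
rewrite (eq_big_seq (fun y => (expR (-1) + b) + b * y)) => [|y yD] /=.
  rewrite sum_affine -mxtrace_eigenvalues // mxtrace_distance_matrix.
  by rewrite size_eigenvalues // /b; field.
have /orP[] := complete_eigenvalue _ _ _ _ eK (eigenvalues_eigenvalue _ _ _ _ Dsym yD).
  by move=> /eqP ->; ring.
by move=> /eqP ->; rewrite /b; field.
Qed.

(** * The lower bound and its equality case *)

(** A nonempty sequence has a greatest element, which can be put first. *)
Lemma perm_eq_max (R : realDomainType) (s : seq R) :
  (0 < size s)%N ->
  exists x0 t, perm_eq s (x0 :: t) /\ {in s, forall x, x <= x0}.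
Proof.
move=> s_gt0; pose t := sort >=%O s.
have pts : perm_eq t s by rewrite perm_sort.
have ts : sorted >=%O t by apply: sort_sorted => x y; apply: le_total.
case: t pts ts => [/perm_size st|x0 t]; first by rewrite -st in s_gt0.
move=> pts st; exists x0, t; rewrite perm_sym; split=> // x.
rewrite -(perm_mem pts) inE => /predU1P[-> //|xt].
move: st => /=; rewrite path_sortedE => [/andP[/allP /(_ _ xt)]//|].
by move=> y x' z /[swap]; apply: le_trans.
Qed.

Theorem corollary2p1 (R : realType) (n m : nat) (e : rel 'I_n)
  (e_simple : simple_graph e) (e_connected : connected_graph e)
  (e_edges : #|edge_set e| = m) :
  let W := wiener_index R e in
  let bound := expR (2 * W / n%:R)
               + (n%:R - 1) / expR (2 * W / (n%:R * (n%:R - 1))) in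
  distance_estrada_index R e >= bound
  /\ (distance_estrada_index R e = bound <-> e =2 complete_graph (n := n)).
Proof.
move=> W bound; have [e_sym e_irr] := e_simple; have [n_gt0 _] := e_connected.
pose x : R := 2 * W / n%:R; pose k : R := 2 * W / (n%:R * (n%:R - 1)).
have n0 : n%:R != 0 :> R by rewrite pnatr_eq0 -lt0n.
have n1 : 0 <= n%:R - 1 :> R by rewrite subr_ge0 ler1n.
have W0 : 0 <= W := wiener_index_ge0 _ _ _.
have xk : x = (n%:R - 1) * k.
  rewrite /x /k; have [n_gt1|] := ltnP 1 n.
    by field; rewrite n0 subr_eq0 gt_eqF ?ltr1n.
  (* For one vertex both sides vanish, and [k] is a division by 0. *)
  move=> n_le1; have -> : 2 * W = 0; last by rewrite !mul0r mulr0.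
  rewrite wiener_indexE big1 // => i _; rewrite big1 // => j _.
  have -> : j = i by apply: val_inj; case: i j => [a an] [b bn] /=; lia.
  by rewrite mxE dist_refl.
have boundE : bound = expR x + (n%:R - 1) * expR (- k) by rewrite expRN.
clearbody bound.
set D := distance_matrix R e.
have Dsym : D^T = D by exact: distance_matrix_sym.
have [x0 [t [Dt maxx0]]] : exists x0 t,
    perm_eq (eigenvalues D) (x0 :: t) /\ {in eigenvalues D, forall x, x <= x0}.
  by apply: perm_eq_max; rewrite size_eigenvalues.
have st : (size t)%:R = n%:R - 1 :> R.
  by rewrite -(size_eigenvalues Dsym) (perm_size Dt) -nat1r addrC addKr.
have sum0 : x0 + \sum_(y <- t) y = 0.
  have := mxtrace_eigenvalues _ _ _ Dsym.
  by rewrite mxtrace_distance_matrix (perm_big _ Dt) big_cons => <-.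
have xx0 : x <= x0 by apply: mean_distance_degree_le.
have k_ge0 : 0 <= k by apply: divr_ge0; apply: mulr_ge0.
have kx : - k <= x by rewrite (@le_trans _ _ 0) ?oppr_le0 // xk mulr_ge0.
have [|ge_bound eq_bound] := sum_expR_ge _ _ _ _ _ kx xx0 sum0.
  by rewrite st xk; ring.
have DEE : distance_estrada_index R e = expR x0 + \sum_(y <- t) expR y.
  by rewrite /distance_estrada_index (perm_big _ Dt) big_cons.
split; first by rewrite boundE DEE -st.
split=> [|eK].
  rewrite boundE DEE -st => /eq_bound[x0x tk].
  apply: (equidistant_complete _ _ R k) => // i j ij.
  have trD2 : \tr (D *m D) = x ^+ 2 + (n%:R - 1) * k ^+ 2.
    rewrite mxtrace_sqr_eigenvalues // (perm_big _ Dt) big_cons x0x -st.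
    (* A constant term, written as an affine function of [y]. *)
    rewrite (eq_big_seq (fun y => k ^+ 2 + 0 * y)) => [|y yt].
      by rewrite sum_affine mul0r addr0.
    by rewrite (tk y yt) sqrrN mul0r addr0.
  have WE : 2 * W = n%:R * x by rewrite [RHS]mulrC /x divfK.
  have := distance_variance R n e k e_sym.
  rewrite -/D -/W WE trD2 xk [RHS](_ : _ = 0); last by ring.
  (* A zero sum of squares has only zero terms. *)
  move/eqP; rewrite psumr_eq0 => [/allP/(_ i)|i' _]; last first.
    by apply: sumr_ge0 => j' _; apply: sqr_ge0.
  rewrite mem_index_enum => /(_ isT)/=.
  rewrite psumr_eq0 => [/allP/(_ j)|j' _]; last exact: sqr_ge0.
  rewrite mem_index_enum => /(_ isT)/=.
  by rewrite sqrf_eq0 subr_eq0 ij mulr1 mxE => /eqP.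
rewrite complete_estrada_index // boundE.
have xE : x = n%:R - 1 by rewrite /x wiener_index_complete // mulrAC divff ?mul1r.
rewrite xE; congr (_ + _).
have /eqP : (n%:R - 1) * (1 - k) = 0 by rewrite mulrBr mulr1 -xk xE subrr.
(* Either n = 1 and both terms vanish, or k = 1. *)
rewrite mulf_eq0 => /orP[/eqP ->|]; first by rewrite !mul0r.
by rewrite subr_eq0 => /eqP <-.
Qed.
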